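(* Let $(\mathfrak g,\mathfrak s,V)$ be a generic kinematical Lie algebra such that the associated siLa $(\mathfrak g,\sigma,\Omega)$ is indecomposable and non-flat. Then the transvection Lie algebra $\underline{\mathfrak g}$ underlying the transvection siLa associated to $(\mathfrak g,\sigma,\Omega)$ naturally carries a structure of generic kinematical Lie algebra $(\underline{\mathfrak g},\underline{\mathfrak s},V)$.
   Context: An $\mathfrak s$-module $M$ over $\mathbb K$ is absolutely simple if it is simple and the only $\mathbb K$-endomorphisms of $M$ commuting with $\mathfrak s$ are the scalars. For an $\mathfrak s$-module $W$ and an irreducible $\mathfrak s$-module $L$, the weak isotypical component of $L$ in $W$ is the vector sum of all submodules of $W$ isomorphic to $L$; ''empty'' means it is $\{0\}$. A generic kinematical Lie algebra over $\mathbb K=\mathbb R$ or $\mathbb C$ is a triple $(\mathfrak g,\mathfrak s,V)$ where $\mathfrak g$ is a finite-dimensional Lie algebra over $\mathbb K$; $\mathfrak s$ is a Lie subalgebra of $\mathfrak g$; $V$ is a faithful absolutely simple finite-dimensional $\mathfrak s$-module over $\mathbb K$ such that the weak isotypical component of $V$ in $\Lambda^2(V)$ is empty and the $\mathfrak s$-action preserves a non-degenerate scalar product on $V$ (not necessarily positive definite); and $\mathfrak g=\mathcal Z\oplus\mathfrak s\oplus\mathcal P$ as a vector space, with $\mathcal P$ an $\mathfrak s$-stable subspace isomorphic to $V\oplus V$ as $\mathfrak s$-module, and $\mathcal Z$ a line centralizing $\mathfrak s$ in $\mathfrak g$. Put $\mathfrak h:=\mathcal Z\oplus\mathfrak s$.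 An iLa is a pair $(\mathfrak g,\sigma)$ with $\sigma$ an involutive automorphism of the finite-dimensional Lie algebra $\mathfrak g$, with $\pm1$-eigenspaces $\mathfrak g=\mathfrak h\oplus\mathcal P$. A symplectic iLa (siLa) is a triple $(\mathfrak g,\sigma,\Omega)$ with in addition $\Omega$ an $\mathfrak h$-invariant non-degenerate skew-symmetric bilinear form on $\mathcal P$. The siLa associated with an (indecomposable, non-flat) generic kinematical Lie algebra is given by $\sigma=\mathrm{id}_{\mathcal Z\oplus\mathfrak s}\oplus(-\mathrm{id}_{\mathcal P})$ and $\Omega(X,Y)=[X,Y]+\mathfrak s\in\mathfrak h/\mathfrak s\simeq\mathbb K$. Flat means $[\mathcal P,\mathcal P]$ centralizes $\mathcal P$; decomposable means isomorphic to a direct sum of two non-trivial iLa's (siLa's); indecomposable means not decomposable. The transvection (s)iLa associated to $(\mathfrak g,\sigma,\Omega)$ is the one induced on $\underline{\mathfrak g}:=([\mathcal P,\mathcal P]\oplus\mathcal P)/\mathfrak n$, where $\mathfrak n$ is the centralizer of $\mathcal P$ in $[\mathcal P,\mathcal P]$; $\underline{\mathfrak g}=\underline{\mathfrak h}\oplus\mathcal P$ with $\underline{\mathfrak h}=[\mathcal P,\mathcal P]/\mathfrak n$ (here $\mathfrak n=0$ since $\mathfrak h$ acts effectively on $\mathcal P$). The subalgebra $\underline{\mathfrak s}$ is the kernel of the restriction to $\underline{\mathfrak h}=[\mathcal P,\mathcal P]\subset\mathfrak h$ of the projection $\mathfrak h\to\mathcal Z$ parallel to $\mathfrak s$; $V$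 is regarded as an $\underline{\mathfrak s}$-module by restriction. *)

(* Defs.v *)
From HB Require Import structures.
From mathcomp Require Import all_boot all_order all_algebra.
From mathcomp Require Import reals complex.

Set Implicit Arguments.
Unset Strict Implicit.
Unset Printing Implicit Defensive.

Import Order.TTheory GRing.Theory Num.Theory.
Local Open Scope ring_scope.

Record lieAlgebra (K : fieldType) := LieAlgebra {
  lie_sort :> vectType K;
  lbr : {bilinear lie_sort -> lie_sort -> lie_sort};
  lbrxx : forall x, lbr x x = 0;
  lbr_jacobi : forall x y z,
    lbr x (lbr y z) + lbr y (lbr z x) + lbr z (lbr x y) = 0 }.

Section LieTheory.
Variables (K : fieldType) (L : lieAlgebra K).
Implicit Types (x y z : L) (U W X : {vspace L}).

Lemma lbrC x y : lbr L x y = - lbr L y x.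
Proof.
apply/eqP; rewrite -addr_eq0; apply/eqP.
have := lbrxx (x + y); rewrite linearDl !linearDr /= !lbrxx.
by rewrite add0r addr0.
Qed.

Lemma lbr_leibniz x y z :
  lbr L x (lbr L y z) = lbr L (lbr L x y) z + lbr L y (lbr L x z).
Proof.
have := lbr_jacobi x y z.
rewrite [lbr L z (lbr L x y)]lbrC [lbr L z x]lbrC linearNr.
by move/eqP; rewrite -addrA -opprD addr_eq0 opprK addrC => /eqP->.
Qed.

(* The linear span of all brackets [u, w], built as [prodv] is. *)
Definition lbrv U W : {vspace L} :=
  <<allpairs (lbr L) (vbasis U) (vbasis W)>>%VS.

Lemma lbrv_subP U W X :
  reflect {in U & W, forall x y, lbr L x y \in X} (lbrv U W <= X)%VS.
Proof.
apply: (iffP span_subvP) => [UWX x y xU yW | UWX _ /allpairsP[[u w] [/= uU wW ->]]].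
  rewrite (coord_vbasis xU) (coord_vbasis yW) linear_sumlz memv_suml // => i _.
  rewrite linear_sumr memv_suml // => j _.
  rewrite linearZl_LR linearZr_LR /= !memvZ // UWX //.
  by apply/allpairsP; exists ((vbasis U)`_i, (vbasis W)`_j);
    rewrite !mem_nth ?size_tuple.
by apply: UWX; apply: vbasis_mem.
Qed.

Lemma memv_lbr U W : {in U & W, forall x y, lbr L x y \in lbrv U W}.
Proof. exact/lbrv_subP. Qed.

Definition lcent U : {vspace L} :=
  (\bigcap_(i < \dim U) lker (linfun (lbr L (vbasis U)`_i)))%VS.

Lemma lcentP U x : reflect {in U, forall u, lbr L x u = 0} (x \in lcent U).
Proof.
apply: (iffP idP) => [|xU].
  rewrite memvE => /subv_bigcapP xU u uU.
  rewrite (coord_vbasis uU) linear_sumr big1 // => i _; rewrite linearZr_LR /=.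
  have := xU i isT; rewrite -memvE memv_ker lfunE /= => /eqP.
  by rewrite lbrC => ->; rewrite oppr0 scaler0.
rewrite memvE; apply/subv_bigcapP => i _; rewrite -memvE memv_ker lfunE /=.
by rewrite lbrC xU ?oppr0 // vbasis_mem // mem_nth ?size_tuple.
Qed.

Definition lie_subalgebra U := {in U &, forall x y, lbr L x y \in U}.

Definition lie_flat P := {in lbrv P P & P, forall x y, lbr L x y = 0}.

End LieTheory.

Definition lie_morphism (K : fieldType) (L M : lieAlgebra K) (f : 'Hom(L, M)) :=
  forall x y, f (lbr L x y) = lbr M (f x) (f y).

Section DirectSum.
Variables (K : fieldType) (L M : lieAlgebra K).
Local Notation LM := (lie_sort L * lie_sort M)%type.

Definition lie_dsum_br (x y : LM) : LM := (lbr L x.1 y.1, lbr M x.2 y.2).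

Fact lie_dsum_bilinear :
  bilinear_for (GRing.Scale.Law.clone _ _ *:%R _)
    (GRing.Scale.Law.clone _ _ *:%R _) lie_dsum_br.
Proof.
split=> [y|x] a [u1 u2] [v1 v2]; rewrite /lie_dsum_br /=;
  by [rewrite !linearPl | rewrite !linearPr].
Qed.
HB.instance Definition _ :=
  bilinear_isBilinear.Build K LM LM LM _ _ lie_dsum_br lie_dsum_bilinear.

Fact lie_dsum_brxx x : lie_dsum_br x x = 0.
Proof. by rewrite /lie_dsum_br !lbrxx. Qed.
Fact lie_dsum_jacobi x y z :
  lie_dsum_br x (lie_dsum_br y z) + lie_dsum_br y (lie_dsum_br z x)
    + lie_dsum_br z (lie_dsum_br x y) = 0.
Proof. by congr pair; rewrite /= lbr_jacobi. Qed.

Definition lie_dsum : lieAlgebra K :=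
  @LieAlgebra K LM lie_dsum_br lie_dsum_brxx lie_dsum_jacobi.

End DirectSum.

(* The Lie algebra E / N, for E a subalgebra of L and N an ideal of E. The
   quotient space is modelled on a complement [E :\: N] of N in E. *)
Section Subquotient.
Variables (K : fieldType) (L : lieAlgebra K) (E N : {vspace L}).

Local Notation Q := (subvs_of (E :\: N)).

Definition subquot_proj (x : L) : Q := vsproj _ (addv_pi1 E N x).

Fact subquot_proj_linear : linear subquot_proj.
Proof. by move=> a x y; rewrite /subquot_proj !linearP. Qed.
HB.instance Definition _ :=
  GRing.isSemilinear.Build K L Q _ subquot_proj
    (GRing.semilinear_linear subquot_proj_linear).

Lemma subquot_reprP (q : Q) : vsval q \in E.
Proof. exact: subvP (diffvSl E N) _ (subvsP q). Qed.

Lemma subquot_reprK (q : Q) : subquot_proj (vsval q) = q.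
Proof.
rewrite /subquot_proj; apply: val_inj; rewrite /= vsprojK ?memv_pi //.
by apply: daddv_pi_id; [exact: capv_diff | exact: subvsP].
Qed.

Hypothesis E_subalg : lie_subalgebra E.
Hypothesis NE : (N <= E)%VS.
Hypothesis N_ideal : {in E & N, forall x y, lbr L x y \in N}.

Lemma subquot_projK x : x \in E -> x - vsval (subquot_proj x) \in N.
Proof.
move=> xE; rewrite vsprojK ?memv_pi //.
rewrite -{1}(@addv_pi1_pi2 _ _ E N x) ?(subvP (addvSl E N)) //.
by rewrite addrC addKr memv_pi2.
Qed.

Lemma subquot_proj_eq0 x : x \in E -> (subquot_proj x == 0) = (x \in N).
Proof.
move=> xE; apply/eqP/idP => [x0|xN].
  by have := subquot_projK xE; rewrite x0 subr0.
have yN : vsval (subquot_proj x) \in N.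
  by rewrite -[vsval _](subKr x) memvB // subquot_projK.
apply: val_inj; apply/eqP; rewrite -memv0 /=.
by rewrite -(capv_diff E N) memv_cap subvsP.
Qed.

Lemma subquot_proj_congr x y :
  x \in E -> x - y \in N -> subquot_proj x = subquot_proj y.
Proof.
move=> xE xyN; apply/eqP; rewrite -subr_eq0 -linearB subquot_proj_eq0 //.
exact: subvP NE _ xyN.
Qed.

Definition subquot_br (a b : Q) : Q := subquot_proj (lbr L (vsval a) (vsval b)).

Fact subquot_bilinear :
  bilinear_for (GRing.Scale.Law.clone _ _ *:%R _)
    (GRing.Scale.Law.clone _ _ *:%R _) subquot_br.
Proof.
have vsvalP c (u v : Q) : vsval (c *: u + v) = c *: vsval u + vsval v.
  exact: linearP.
split=> b c u v; rewrite /subquot_br vsvalP ?linearPl ?linearPr;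
  exact: subquot_proj_linear.
Qed.
HB.instance Definition _ :=
  bilinear_isBilinear.Build K Q Q Q _ _ subquot_br subquot_bilinear.

Lemma subquot_proj_br : {in E &, forall x y,
  subquot_proj (lbr L x y) = subquot_br (subquot_proj x) (subquot_proj y)}.
Proof.
move=> x y xE yE; set x' := subquot_proj x; set y' := subquot_proj y.
apply: subquot_proj_congr; first exact: E_subalg.
have -> : lbr L x y - lbr L (vsval x') (vsval y') =
    lbr L x (y - vsval y') - lbr L (vsval y') (x - vsval x').
  rewrite !linearBr /= [lbr L _ x]lbrC [lbr L _ (vsval x')]lbrC.
  by rewrite opprB opprK [- _ + _]addrC addrA subrK.
by rewrite memvB // N_ideal ?subquot_projK // subquot_reprP.
Qed.

Fact subquot_brxx a : subquot_br a a = 0.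
Proof. by rewrite /subquot_br lbrxx linear0. Qed.

Fact subquot_jacobi a b c :
  subquot_br a (subquot_br b c) + subquot_br b (subquot_br c a)
    + subquot_br c (subquot_br a b) = 0.
Proof.
rewrite -[a]subquot_reprK -[b]subquot_reprK -[c]subquot_reprK.
by rewrite -!subquot_proj_br ?E_subalg ?subquot_reprP // -!linearD lbr_jacobi
  linear0.
Qed.

Definition lie_subquot : lieAlgebra K :=
  @LieAlgebra K Q subquot_br subquot_brxx subquot_jacobi.

End Subquotient.

Record iLa (K : numFieldType) := ILa {
  ila_lie :> lieAlgebra K;
  ila_sigma : 'End(ila_lie);
  ila_sigma_br : lie_morphism ila_sigma;
  ila_sigmaK : involutive ila_sigma }.

Definition ila_h (K : numFieldType) (S : iLa K) : {vspace S} :=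
  passmx.leigenspace (ila_sigma S) 1.
Definition ila_P (K : numFieldType) (S : iLa K) : {vspace S} :=
  passmx.leigenspace (ila_sigma S) (-1).

Definition ila_flat (K : numFieldType) (S : iLa K) := lie_flat (ila_P S).

(* [sila_omega] encodes a bilinear form on [ila_P]: its values outside of
   [ila_P] are irrelevant. *)
Record siLa (K : numFieldType) := SiLa {
  sila_ila :> iLa K;
  sila_omega : {biscalar sila_ila};
  sila_skew :
    {in ila_P sila_ila &, forall p q, sila_omega p q = - sila_omega q p};
  sila_nondeg : {in ila_P sila_ila, forall p,
    {in ila_P sila_ila, forall q, sila_omega p q = 0} -> p = 0};
  sila_inv : {in ila_h sila_ila, forall x, {in ila_P sila_ila &, forall p q,
    sila_omega (lbr _ x p) q + sila_omega p (lbr _ x q) = 0}} }.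

Section ILaTheory.
Variables (K : numFieldType) (S : iLa K).
Local Notation sigma := (ila_sigma S).
Local Notation h := (ila_h S).
Local Notation P := (ila_P S).
Implicit Types x y p q : S.

Lemma ila_hP x : reflect (sigma x = x) (x \in h).
Proof.
rewrite /ila_h /passmx.leigenspace memv_ker add_lfunE opp_lfunE scale_lfunE id_lfunE.
by rewrite scale1r subr_eq0; apply: eqP.
Qed.

Lemma ila_PP x : reflect (sigma x = - x) (x \in P).
Proof.
rewrite /ila_P /passmx.leigenspace memv_ker add_lfunE opp_lfunE scale_lfunE id_lfunE.
by rewrite scaleN1r subr_eq0; apply: eqP.
Qed.

Lemma ila_hP0 : (P :&: h = 0)%VS.
Proof.
apply/eqP; rewrite -subv0; apply/subvP => x; rewrite memv_cap => /andP[].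
move=> /ila_PP xN /ila_hP; rewrite xN memv0 => /eqP.
by rewrite -subr_eq0 -opprD oppr_eq0 -mulr2n -scaler_nat scaler_eq0 pnatr_eq0.
Qed.

Lemma ila_PPh : (lbrv P P <= h)%VS.
Proof.
apply/lbrv_subP => x y /ila_PP xP /ila_PP yP; apply/ila_hP.
by rewrite ila_sigma_br xP yP linearNl linearNr opprK.
Qed.

Lemma ila_hPP : {in h & P, forall x p, lbr S x p \in P}.
Proof.
move=> x p /ila_hP xh /ila_PP pP; apply/ila_PP.
by rewrite ila_sigma_br xh pP linearNr.
Qed.

(* The transvection siLa is carried by [transv_E / transv_n]. *)
Definition transv_E : {vspace S} := (lbrv P P + P)%VS.
Definition transv_n : {vspace S} := (lbrv P P :&: lcent P)%VS.

Fact transv_E_decomp x : x \in transv_E ->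
  exists u v, [/\ u \in lbrv P P, v \in P & x = u + v].
Proof. by move=> /memv_addP[u uPP [v vP ->]]; exists u, v. Qed.

Fact transv_PP_subalg : lie_subalgebra (lbrv P P).
Proof.
move=> x y xPP; have xh := subvP ila_PPh _ xPP.
suff /subvP sub : (lbrv P P <= linfun (lbr S x) @^-1: lbrv P P)%VS.
  by move=> /sub; rewrite -memv_preim lfunE.
apply/lbrv_subP => p q pP qP; rewrite -memv_preim lfunE /= lbr_leibniz.
by rewrite memvD // memv_lbr // ila_hPP.
Qed.

Fact transv_E_subalg : lie_subalgebra transv_E.
Proof.
move=> _ _ /transv_E_decomp[u [p [uPP pP ->]]] /transv_E_decomp[v [q [vPP qP ->]]].
have uh := subvP ila_PPh _ uPP; have vh := subvP ila_PPh _ vPP.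
rewrite linearDl !linearDr /= [lbr S p v]lbrC -addrA memvD //.
  by rewrite (subvP (addvSl _ _)) ?transv_PP_subalg.
rewrite memvD ?(subvP (addvSr _ _) _ (ila_hPP uh qP)) // memvD //.
  by rewrite memvN (subvP (addvSr _ _)) ?ila_hPP.
by rewrite (subvP (addvSl _ _)) ?memv_lbr.
Qed.

Fact transv_nE : (transv_n <= transv_E)%VS.
Proof. exact: subv_trans (capvSl _ _) (addvSl _ _). Qed.

Fact transv_n_ideal :
  {in transv_E & transv_n, forall x y, lbr S x y \in transv_n}.
Proof.
move=> _ y /transv_E_decomp[u [p [uPP pP ->]]].
rewrite memv_cap => /andP[yPP /lcentP yP].
rewrite linearDl /= [lbr S p y]lbrC yP // oppr0 addr0 memv_cap.
rewrite transv_PP_subalg //=; apply/lcentP => q qP.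
have uh := subvP ila_PPh _ uPP.
have := lbr_leibniz u y q; rewrite yP // linear0r yP ?addr0 //.
exact: ila_hPP.
Qed.

Definition transv_lie : lieAlgebra K :=
  lie_subquot transv_E_subalg transv_nE transv_n_ideal.

Definition transv_proj : 'Hom(S, transv_lie) :=
  linfun (subquot_proj transv_E transv_n : S -> transv_lie).

Definition transv_repr : 'Hom(transv_lie, S) :=
  linfun (vsval : subvs_of (transv_E :\: transv_n) -> S).

Lemma transv_reprP (a : transv_lie) : transv_repr a \in transv_E.
Proof. by rewrite lfunE; apply: subquot_reprP. Qed.

Lemma transv_reprK : cancel transv_repr transv_proj.
Proof. by move=> a; rewrite !lfunE; apply: subquot_reprK. Qed.

Lemma transv_projK x : x \in transv_E ->
  x - transv_repr (transv_proj x) \in transv_n.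
Proof. by move=> xE; rewrite !lfunE; exact: (subquot_projK _ xE). Qed.

Lemma transv_proj_eq0 x : x \in transv_E ->
  (transv_proj x == 0) = (x \in transv_n).
Proof. by move=> xE; rewrite !lfunE; exact: (subquot_proj_eq0 _ xE). Qed.

Lemma transv_proj_congr x y :
  x \in transv_E -> x - y \in transv_n -> transv_proj x = transv_proj y.
Proof.
by move=> xE xy; rewrite !lfunE; exact: (subquot_proj_congr transv_nE xE xy).
Qed.

Lemma transv_proj_br : {in transv_E &, forall x y,
  transv_proj (lbr S x y) = lbr transv_lie (transv_proj x) (transv_proj y)}.
Proof.
move=> x y xE yE; rewrite !lfunE.
exact: (subquot_proj_br transv_E_subalg transv_nE transv_n_ideal).
Qed.

Definition transv_sigma : 'End(transv_lie) :=
  (transv_proj \o (sigma \o transv_repr))%VF.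

Fact sigma_n x : x \in transv_n -> sigma x = x.
Proof. by rewrite memv_cap => /andP[/(subvP ila_PPh)/ila_hP]. Qed.

Fact sigma_E x : x \in transv_E -> sigma x \in transv_E.
Proof.
move=> /transv_E_decomp[u [p [uPP pP ->]]]; rewrite linearD /=.
have /ila_hP-> := subvP ila_PPh _ uPP; have /ila_PP-> := pP.
by rewrite memv_add // memvN.
Qed.

Lemma transv_sigmaE x : x \in transv_E ->
  transv_sigma (transv_proj x) = transv_proj (sigma x).
Proof.
move=> xE; rewrite /transv_sigma !comp_lfunE; apply/esym/transv_proj_congr.
  exact: sigma_E.
by rewrite -linearB /= sigma_n transv_projK.
Qed.

Fact transv_sigma_br : lie_morphism transv_sigma.
Proof.
move=> a b; rewrite -[a]transv_reprK -[b]transv_reprK.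
have [aE bE] := (transv_reprP a, transv_reprP b).
rewrite -transv_proj_br // !transv_sigmaE ?transv_E_subalg //.
by rewrite ila_sigma_br transv_proj_br ?sigma_E.
Qed.

Fact transv_sigmaK : involutive transv_sigma.
Proof.
move=> a; rewrite -[a in LHS]transv_reprK !transv_sigmaE ?sigma_E ?transv_reprP //.
by rewrite ila_sigmaK transv_reprK.
Qed.

Definition transv_iLa : iLa K := ILa transv_sigma_br transv_sigmaK.

Lemma transv_decomp (a : transv_iLa) : exists u p,
  [/\ u \in lbrv P P, p \in P, a = transv_proj u + transv_proj p
    & ila_sigma transv_iLa a = transv_proj u - transv_proj p].
Proof.
have [u [p [uPP pP ap]]] := transv_E_decomp (transv_reprP a).
exists u, p; split=> //; first by rewrite -linearD -ap; exact/esym/transv_reprK.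
rewrite -[a]transv_reprK transv_sigmaE ?transv_reprP // ap linearD /=.
have /ila_hP-> := subvP ila_PPh _ uPP; have /ila_PP-> := pP.
exact: linearB.
Qed.

End ILaTheory.

Section TransvP.
Variables (K : numFieldType) (S : iLa K).

Lemma transv_hP (a : transv_iLa S) :
  reflect (exists2 u, u \in lbrv (ila_P S) (ila_P S) & a = transv_proj S u)
    (a \in ila_h (transv_iLa S)).
Proof.
apply: (iffP (ila_hP _)) => [|[u uPP ->]]; last first.
  rewrite transv_sigmaE ?(subvP (addvSl _ _)) //.
  by have /ila_hP-> := subvP (ila_PPh S) _ uPP.
have [u [p [uPP pP -> ->]]] := transv_decomp a.
move/(congr1 (fun b => - transv_proj S u + b)); rewrite !addKr => /esym/eqP.
rewrite -addr_eq0 -mulr2n -scaler_nat scaler_eq0 pnatr_eq0 => /eqP->.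
by exists u; rewrite ?addr0.
Qed.

Lemma transv_PP (a : transv_iLa S) :
  reflect (exists2 p, p \in ila_P S & a = transv_proj S p)
    (a \in ila_P (transv_iLa S)).
Proof.
apply: (iffP (ila_PP _)) => [|[p pP ->]]; last first.
  rewrite transv_sigmaE ?(subvP (addvSr _ _)) //.
  by have /ila_PP-> := pP; rewrite linearN.
have [u [p [uPP pP -> ->]]] := transv_decomp a.
rewrite opprD => /addIr/eqP.
rewrite -addr_eq0 -mulr2n -scaler_nat scaler_eq0 pnatr_eq0 => /eqP->.
by exists p; rewrite ?add0r.
Qed.

End TransvP.

Section TransvSiLa.
Variables (K : numFieldType) (S : siLa K).
Local Notation h := (ila_h S).
Local Notation P := (ila_P S).
Local Notation T := (transv_iLa S).

(* The inverse, on the P-part of the transvection, of the isomorphism induced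
   by [transv_proj] on P: a representative is only defined up to n, so it has
   to be projected onto P along h. *)
Definition transv_pr : 'Hom(T, S) := (daddv_pi P h \o transv_repr S)%VF.

Lemma transv_prK p : p \in P -> transv_pr (transv_proj S p) = p.
Proof.
move=> pP; have pE : p \in transv_E S by rewrite (subvP (addvSr _ _)).
set n := p - transv_repr S (transv_proj S p).
have nh : n \in h.
  by apply: (subvP (subv_trans (capvSl _ _) (ila_PPh S)) n); apply: transv_projK.
rewrite comp_lfunE -[transv_repr S _](subKr p) -/n linearB /=.
rewrite (daddv_pi_id (ila_hP0 S) pP).
have nPh : n \in (P + h)%VS by rewrite (subvP (addvSr _ _)).
have := daddv_pi_add (ila_hP0 S) nPh.
rewrite (daddv_pi_id _ nh) 1?capvC ?ila_hP0 // => /(canRL (addrK _)) ->.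
by rewrite subrr subr0.
Qed.

Definition transv_omega (a b : T) : K :=
  sila_omega S (transv_pr a) (transv_pr b).

Fact transv_omega_bilinear :
  bilinear_for (GRing.Scale.Law.clone _ _ *%R _)
    (GRing.Scale.Law.clone _ _ *%R _) transv_omega.
Proof.
by split=> b c u v; rewrite /transv_omega linearP ?linearPl ?linearPr.
Qed.
HB.instance Definition _ :=
  bilinear_isBilinear.Build K T T K _ _ transv_omega transv_omega_bilinear.

Lemma transv_omegaE : {in P &, forall p q,
  transv_omega (transv_proj S p) (transv_proj S q) = sila_omega S p q}.
Proof. by move=> p q pP qP; rewrite /transv_omega !transv_prK. Qed.

Fact transv_skew : {in ila_P T &, forall a b,
  transv_omega a b = - transv_omega b a}.
Proof.
move=> _ _ /transv_PP[p pP ->] /transv_PP[q qP ->].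
by rewrite !transv_omegaE // sila_skew.
Qed.

Fact transv_nondeg : {in ila_P T, forall a,
  {in ila_P T, forall b, transv_omega a b = 0} -> a = 0}.
Proof.
move=> _ /transv_PP[p pP ->] p0; rewrite (sila_nondeg pP) ?linear0 // => q qP.
by rewrite -transv_omegaE // p0 //; apply/transv_PP; exists q.
Qed.

Fact transv_inv : {in ila_h T, forall x, {in ila_P T &, forall a b,
  transv_omega (lbr T x a) b + transv_omega a (lbr T x b) = 0}}.
Proof.
move=> _ /transv_hP[u uPP ->] _ _ /transv_PP[p pP ->] /transv_PP[q qP ->].
have uh := subvP (ila_PPh S) _ uPP.
have uE : u \in transv_E S by rewrite (subvP (addvSl _ _)).
have PE : {subset P <= transv_E S} := subvP (addvSr _ _).
rewrite -!transv_proj_br // ?PE // !transv_omegaE ?ila_hPP //.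
exact: sila_inv.
Qed.

Definition transvection : siLa K :=
  @SiLa K T transv_omega transv_skew transv_nondeg transv_inv.

End TransvSiLa.

Section SiLaDirectSum.
Variables (K : numFieldType) (S1 S2 : siLa K).
Local Notation L := (lie_dsum S1 S2).

Definition dsum_sigma_fun (x : L) : L := (ila_sigma S1 x.1, ila_sigma S2 x.2).
Fact dsum_sigma_linear : linear dsum_sigma_fun.
Proof. by move=> c x y; rewrite /dsum_sigma_fun /= !linearP. Qed.
HB.instance Definition _ :=
  GRing.isSemilinear.Build K L L _ dsum_sigma_fun
    (GRing.semilinear_linear dsum_sigma_linear).

Definition dsum_sigma : 'End(L) := linfun dsum_sigma_fun.

Fact dsum_sigma_br : lie_morphism dsum_sigma.
Proof. by move=> x y; rewrite !lfunE; congr pair; exact: ila_sigma_br. Qed.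
Fact dsum_sigmaK : involutive dsum_sigma.
Proof.
by case=> x y; rewrite !lfunE /= /dsum_sigma_fun /= !ila_sigmaK.
Qed.

Definition ila_dsum : iLa K := ILa dsum_sigma_br dsum_sigmaK.

Lemma dsum_hE (x : ila_dsum) :
  (x \in ila_h ila_dsum) = (x.1 \in ila_h S1) && (x.2 \in ila_h S2).
Proof.
case: x => x1 x2; apply/ila_hP/andP; rewrite lfunE.
  by case=> h1 h2; split; apply/ila_hP.
by case=> /ila_hP h1 /ila_hP h2; congr pair.
Qed.

Lemma dsum_PE (x : ila_dsum) :
  (x \in ila_P ila_dsum) = (x.1 \in ila_P S1) && (x.2 \in ila_P S2).
Proof.
case: x => x1 x2; apply/ila_PP/andP; rewrite lfunE.
  by case=> h1 h2; split; apply/ila_PP.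
by case=> /ila_PP h1 /ila_PP h2; congr pair.
Qed.

Definition dsum_omega (x y : ila_dsum) : K :=
  sila_omega S1 x.1 y.1 + sila_omega S2 x.2 y.2.

Fact dsum_omega_bilinear :
  bilinear_for (GRing.Scale.Law.clone _ _ *%R _)
    (GRing.Scale.Law.clone _ _ *%R _) dsum_omega.
Proof.
split=> y c u v; rewrite /dsum_omega /= ?linearPl ?linearPr mulrDr;
  by rewrite addrACA.
Qed.
HB.instance Definition _ :=
  bilinear_isBilinear.Build K ila_dsum ila_dsum K _ _ dsum_omega
    dsum_omega_bilinear.

Fact dsum_skew : {in ila_P ila_dsum &, forall p q,
  dsum_omega p q = - dsum_omega q p}.
Proof.
move=> p q; rewrite !dsum_PE => /andP[p1 p2] /andP[q1 q2].
by rewrite /dsum_omega (sila_skew p1 q1) (sila_skew p2 q2) opprD.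
Qed.

Fact dsum_nondeg : {in ila_P ila_dsum, forall p,
  {in ila_P ila_dsum, forall q, dsum_omega p q = 0} -> p = 0}.
Proof.
case=> p1 p2; rewrite dsum_PE => /andP[/= p1P p2P] p0.
congr pair.
  apply: (sila_nondeg p1P) => q qP; have := p0 (q, 0).
  by rewrite dsum_PE /= qP mem0v /dsum_omega /= linear0r addr0; apply.
apply: (sila_nondeg p2P) => q qP; have := p0 (0, q).
by rewrite dsum_PE /= qP mem0v /dsum_omega /= linear0r add0r; apply.
Qed.

Fact dsum_inv : {in ila_h ila_dsum, forall x, {in ila_P ila_dsum &, forall p q,
  dsum_omega (lbr ila_dsum x p) q + dsum_omega p (lbr ila_dsum x q) = 0}}.
Proof.
move=> x; rewrite dsum_hE => /andP[x1 x2] p q.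
rewrite !dsum_PE => /andP[p1 p2] /andP[q1 q2].
by rewrite /dsum_omega /= addrACA (sila_inv x1) // (sila_inv x2) // addr0.
Qed.

Definition sila_dsum : siLa K :=
  @SiLa K ila_dsum dsum_omega dsum_skew dsum_nondeg dsum_inv.

End SiLaDirectSum.

Definition sila_iso (K : numFieldType) (S T : siLa K) :=
  exists f : 'Hom(S, T),
  [/\ lie_morphism f, bijective f,
      forall x, f (ila_sigma S x) = ila_sigma T (f x)
    & {in ila_P S &, forall p q, sila_omega T (f p) (f q) = sila_omega S p q}].

Definition sila_decomposable (K : numFieldType) (S : siLa K) :=
  exists S1 S2 : siLa K,
  [/\ {:S1}%VS != 0%VS, {:S2}%VS != 0%VS & sila_iso S (sila_dsum S1 S2)].

(* Modules over a subalgebra [s] of [L]. An action is a function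
   [L -> W -> W], of which only the restriction to [s] matters. *)

Section Modules.
Variables (K : fieldType) (L : lieAlgebra K) (s : {vspace L}).

Section OneModule.
Variables (W : vectType K) (act : L -> W -> W).

Definition lie_module :=
  [/\ {in s, forall x, linear (act x)},
      forall c v, {in s &, forall x y,
        act (c *: x + y) v = c *: act x v + act y v}
    & {in s &, forall x y v,
        act (lbr L x y) v = act x (act y v) - act y (act x v)}].

Definition faithful_module :=
  {in s, forall x, (forall v, act x v = 0) -> x = 0}.

Definition submodule (U : {vspace W}) :=
  {in s & U, forall x u, act x u \in U}.

Definition simple_module := {:W}%VS != 0%VS /\
  forall U : {vspace W}, submodule U -> U = 0%VS \/ U = fullv.

Definition abs_simple_module := simple_module /\
  forall f : 'End(W), {in s, forall x v, f (act x v) = act x (f v)} ->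
    exists c, f = c *: \1%VF.

End OneModule.

(* [U] is a submodule of [W], and is isomorphic to the module [M]. *)
Definition submodule_iso (M W : vectType K) (actM : L -> M -> M)
    (actW : L -> W -> W) (U : {vspace W}) :=
  submodule actW U /\ exists f : 'Hom(M, W),
    [/\ injective f, limg f = U
      & {in s, forall x v, f (actM x v) = actW x (f v)}].

(* Membership in the weak isotypical component of [M] in the submodule [X] of
   [W]: the elements of the sum of all the submodules of [X] isomorphic to
   [M], a possibly infinite family. *)
Definition weak_isotypic (M W : vectType K) (actM : L -> M -> M)
    (actW : L -> W -> W) (X : {vspace W}) (w : W) :=
  exists2 r : seq {vspace W},
    (forall U, U \in r -> (U <= X)%VS /\ submodule_iso actM actW U)
    & w \in (\sum_(U <- r) U)%VS.

End Modules.

Definition dsum_act (K : fieldType) (L : lieAlgebra K) (V W : vectType K)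
    (actV : L -> V -> V) (actW : L -> W -> W) (x : L) (v : V * W) : V * W :=
  (actV x v.1, actW x v.2).

(* The tensor square of [V] is modelled, in coordinates, on square matrices,
   and its exterior square on the antisymmetric tensors (we are in
   characteristic 0), spanned by the [v ^ w = v (x) w - w (x) v]. *)
Section ExteriorSquare.
Variables (K : numFieldType) (V : vectType K).
Local Notation V2 := 'M[K]_(\dim {:V}).
Local Notation e := (vbasis {:V}).

Definition tensor2 (v w : V) : V2 := (passmx.rVof e v)^T *m passmx.rVof e w.

Definition wedge2 (v w : V) : V2 := tensor2 v w - tensor2 w v.

Definition ext2 : {vspace V2} :=
  <<allpairs wedge2 (vbasis {:V}) (vbasis {:V})>>%VS.

Definition tensor2_act (f : 'End(V)) (t : V2) : V2 :=
  (passmx.mxof e e f)^T *m t + t *m passmx.mxof e e f.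

Lemma tensor2_actE f v w :
  tensor2_act f (tensor2 v w) = tensor2 (f v) w + tensor2 v (f w).
Proof.
have rVf u : passmx.rVof e (f u) = passmx.rVof e u *m passmx.mxof e e f.
  by apply: passmx.rVof_app; exact: vbasisP.
by rewrite /tensor2_act /tensor2 !rVf trmx_mul !mulmxA.
Qed.

Lemma ext2_actE f v w :
  tensor2_act f (wedge2 v w) = wedge2 (f v) w + wedge2 v (f w).
Proof.
rewrite /tensor2_act mulmxBr mulmxBl addrACA -opprD.
rewrite -!/(tensor2_act _ _) !tensor2_actE /wedge2.
by rewrite [tensor2 (f w) v + _]addrC opprD addrACA.
Qed.

Lemma memv_wedge2 v w : wedge2 v w \in ext2.
Proof.
have wP c u1 u2 u : wedge2 (c *: u1 + u2) u = c *: wedge2 u1 u + wedge2 u2 u.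
  rewrite /wedge2 /tensor2 !passmx.rVof_linear linearP /= mulmxDl mulmxDr.
  by rewrite -scalemxAl -scalemxAr scalerBr opprD addrACA.
have wC u1 u2 : wedge2 u1 u2 = - wedge2 u2 u1 by rewrite /wedge2 opprB.
have w0 u : wedge2 0 u = 0.
  by have := wP (-1) 0 0 u; rewrite scaler0 add0r scaleN1r addNr.
have w_sum (X : {vspace V2}) u :
    (forall i : 'I_(\dim {:V}), wedge2 (vbasis {:V})`_i u \in X) ->
  forall v', wedge2 v' u \in X.
  move=> wX v'; rewrite (coord_vbasis (memvf v')).
  elim/big_rec: _ => [|i x _ xX]; first by rewrite w0 mem0v.
  by rewrite wP memvD // memvZ.
apply: (w_sum) => i; rewrite wC memvN; apply: (w_sum) => j.
rewrite memv_span //; apply/allpairsP.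
by exists ((vbasis {:V})`_j, (vbasis {:V})`_i);
  rewrite !mem_nth ?size_tuple.
Qed.

End ExteriorSquare.

Definition ext2_act (K : numFieldType) (L : lieAlgebra K) (V : vectType K)
    (act : L -> V -> V) (x : L) : 'M[K]_(\dim {:V}) -> 'M[K]_(\dim {:V}) :=
  tensor2_act (linfun (act x)).

(* [(g, s, V)] is a generic kinematical Lie algebra, with [Z] and [P] as its
   chosen complements of [s]. *)
Record generic_kinematical (K : numFieldType) (g : lieAlgebra K)
    (s : {vspace g}) (V : vectType K) (act : g -> V -> V) (Z P : {vspace g})
    : Prop := GenericKinematical {
  gk_subalgebra : lie_subalgebra s;
  gk_module : lie_module s act;
  gk_faithful : faithful_module s act;
  gk_abs_simple : abs_simple_module s act;
  gk_ext2 : forall w, weak_isotypic s act (ext2_act act) (ext2 V) w -> w = 0;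
  gk_scalar_product : exists B : {symmetric V}, nondegenerate B /\
    {in s, forall x v w, B (act x v) w + B v (act x w) = 0};
  gk_directv : directv (Z + s + P);
  gk_sum : (Z + s + P = fullv)%VS;
  gk_line : \dim Z = 1%N;
  gk_central : {in Z & s, forall z x, lbr g z x = 0};
  gk_P : submodule_iso s (dsum_act act act) (lbr g) P }.

(* [S] is the siLa associated with [(g, s, V)], where [g] is the Lie algebra
   underlying [S]. The identification of h / s with K amounts to the choice of
   a generator [z] of the line [Z]. *)
Definition associated_sila (K : numFieldType) (S : siLa K)
    (s Z P : {vspace S}) :=
  [/\ {in (Z + s)%VS, forall x, ila_sigma S x = x},
      {in P, forall x, ila_sigma S x = - x}
    & exists2 z, Z = <[z]>%VS &
      {in P &, forall x y, lbr S x y - sila_omega S x y *: z \in s}].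

(* The kernel in [P, P] of the projection of Z (+) s onto Z along s. *)
Definition kinematical_s (K : numFieldType) (S : siLa K) (s Z P : {vspace S})
    : {vspace S} :=
  (lbrv P P :&: lker (daddv_pi Z s))%VS.

(* Main.v *)
(* Identify P with V (x) K^2. By Schur's lemma a generator z of Z acts on P
   through a 2 x 2 matrix A, and Omega is B (x) epsilon for the invariant scalar
   product B and a nonzero alternating form epsilon on K^2. If A is scalar, it
   vanishes since Omega is z-invariant; the Jacobi identity on P then forces
   [P, P] to lie in Z, and g is flat. If A is not scalar, some e in K^2 is not an
   eigenvector of A, and the Jacobi identity shows that the brackets
   [v (x) e, w (x) e] act on V as nonzero multiples of the elementary rotations
   u |-> B(w, u) v - B(v, u) w, which span so(V, B). Hence [P, P] contains s, then
   also Z, so that [P, P] = h acts effectively on P: the transvection algebra is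
   g itself, and its kinematical structure is that of g. *)
Require Import Defs.
From HB Require Import structures.
From mathcomp Require Import all_boot all_order all_algebra.
From mathcomp Require Import reals complex.

Set Implicit Arguments.
Unset Strict Implicit.
Unset Printing Implicit Defensive.

Import GRing.Theory Num.Theory.
Local Open Scope ring_scope.

(** Serves the maps below whose linearity is a proved fact rather than a declared structure. *)
Lemma linfun_eq (K : fieldType) (U V : vectType K) (F : U -> V) :
  linear F -> linfun F =1 F.
Proof.
move=> F_lin.
pose m := GRing.isSemilinear.Build K U V _ F (GRing.semilinear_linear F_lin).
pose F' : {linear U -> V} := HB.pack F m.
exact: (lfunE F').
Qed.

(** * Dual bases for a nondegenerate symmetric form *)

Section SymmetricForm.
Variables (K : fieldType) (V : vectType K) (B : {symmetric V}).
Hypothesis B_nondeg : nondegenerate B.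

Lemma symmetric_formC v w : B v w = B w v.
Proof. by rewrite [LHS]hermC expr0 mul1r. Qed.

Lemma nondegenerate_eq0 v : (forall w, B v w = 0) -> v = 0.
Proof.
move=> v0; apply/eqP; rewrite -memv0 -(eqP B_nondeg).
by apply/mem_orthovP => w _.
Qed.

Lemma dual_bases : exists e f : 'I_(\dim {:V}) -> V,
  (forall v, v = \sum_i B v (f i) *: e i) /\
  (forall v, v = \sum_i B v (e i) *: f i).
Proof.
pose e (i : 'I_(\dim {:V})) := (vbasis {:V})`_i.
pose F v := \row_i B v (e i).
have F_lin : linear F.
  by move=> a u v; apply/rowP => i; rewrite !mxE linearPl.
have FE := linfun_eq F_lin.
have e_sep u v : (forall i, B u (e i) = B v (e i)) -> u = v.
  move=> uv; apply/eqP; rewrite -subr_eq0; apply/eqP/nondegenerate_eq0 => w.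
  rewrite (coord_vbasis (memvf w)) linear_sumr big1 // => i _.
  by rewrite linearZr_LR /= linearBl /= [B u _]uv subrr mulr0.
(* Injective by nondegeneracy, hence bijective by dimension; [f] is the preimage of the standard
   basis of row vectors. *)
have kerF : lker (linfun F) == 0%VS.
  apply/lker0P => u v; rewrite !FE => /rowP uv; apply: e_sep => i.
  by have := uv i; rewrite !mxE.
have imF : limg (linfun F) = fullv.
  apply/eqP; rewrite -dimv_leqif_eq ?subvf // limg_dim_eq ?(eqP kerF) ?capv0 //.
  by rewrite !dimvf /dim /= mul1n.
pose f i := ((linfun F)^-1)%VF (delta_mx 0 i).
have B_dual i j : B (f i) (e j) = (i == j)%:R.
  have : linfun F (f i) = delta_mx 0 i by rewrite limg_lfunVK // imF memvf.
  by rewrite FE => /rowP/(_ j); rewrite !mxE eqxx eq_sym.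
exists e, f; split=> v.
  rewrite [LHS](coord_vbasis (memvf v)); apply: eq_bigr => i _.
  congr (_ *: _); rewrite [in RHS](coord_vbasis (memvf v)) linear_sumlz.
  rewrite (bigD1 i) //= linearZl_LR /= symmetric_formC B_dual eqxx mulr1.
  rewrite big1 ?addr0 // => j ji.
  by rewrite linearZl_LR /= symmetric_formC B_dual eq_sym (negPf ji) mulr0.
apply: e_sep => k; rewrite linear_sumlz (bigD1 k) //= linearZl_LR /=.
rewrite B_dual eqxx mulr1 big1 ?addr0 // => j jk.
by rewrite linearZl_LR /= B_dual (negPf jk) mulr0.
Qed.

End SymmetricForm.

(** * The eigenspaces of the involution and the frames of [P] *)

Section Kinematical.
Variables (K : numFieldType) (g : siLa K) (s Z P : {vspace g}).
Variables (V : vectType K) (act : g -> V -> V).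
Hypothesis gV : generic_kinematical s act Z P.
Hypothesis g_associated : associated_sila s Z P.

Local Notation "[ x , y ]" := (lbr g x y) (at level 0) : ring_scope.
Local Notation Omega := (sila_omega g).

Definition intertwines (W : vectType K) (j : 'Hom(V, W)) (actW : g -> W -> W) :=
  {in s, forall x v, actW x (j v) = j (act x v)}.

Lemma gk_h_sub : (Z + s <= ila_h g)%VS.
Proof.
by have [h1 _ _] := g_associated; apply/subvP => x xh; apply/ila_hP/h1.
Qed.

Lemma gk_P_sub : (P <= ila_P g)%VS.
Proof.
by have [_ P1 _] := g_associated; apply/subvP => x xP; apply/ila_PP/P1.
Qed.

Lemma gk_decomp x : exists y p, [/\ y \in (Z + s)%VS, p \in P & x = y + p].
Proof.
have : x \in (Z + s + P)%VS by rewrite (gk_sum gV) memvf.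
by case/memv_addP => y yh [p pP ->]; exists y, p.
Qed.

(** One inclusion is given by the action of [sigma]. Since [Z + s + P] is everything and the two
    eigenspaces meet in 0, neither can be larger. *)
Lemma gk_hE : ila_h g = (Z + s)%VS.
Proof.
apply/eqP; rewrite eqEsubv gk_h_sub andbT; apply/subvP => x xh.
have [y [p [yh pP xE]]] := gk_decomp x.
suff p0 : p = 0 by rewrite xE p0 addr0.
apply/eqP; rewrite -memv0 -(ila_hP0 g) memv_cap (subvP gk_P_sub) //=.
by rewrite -(addKr y p) -xE addrC memvB // (subvP gk_h_sub).
Qed.

Lemma gk_PE : ila_P g = P.
Proof.
apply/eqP; rewrite eqEsubv gk_P_sub andbT; apply/subvP => x xP.
have [y [p [yh pP xE]]] := gk_decomp x.
suff y0 : y = 0 by rewrite xE y0 add0r.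
apply/eqP; rewrite -memv0 -(ila_hP0 g) memv_cap (subvP gk_h_sub) // andbT.
by rewrite -(addrK p y) -xE memvB // (subvP gk_P_sub).
Qed.

Lemma schur (f : 'End(V)) : intertwines f act -> exists c, forall v, f v = c *: v.
Proof.
move=> fs; have [_ /(_ f)] := gk_abs_simple gV.
case=> [x xs v|c ->]; first by rewrite fs.
by exists c => v; rewrite scale_lfunE id_lfunE.
Qed.

(* A frame identifies [P] with [V (x) K^2]. *)
Record frame (j j' : 'Hom(V, g)) : Prop := Frame {
  frame_l : intertwines j (lbr g);
  frame_r : intertwines j' (lbr g);
  frame_P : forall p, p \in P <-> exists v w, p = j v + j' w;
  frame_inj : forall v w, j v + j' w = 0 -> v = 0 /\ w = 0 }.

Lemma frame_lP j j' v : frame j j' -> j v \in P.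
Proof. by move=> fr; apply/(frame_P fr); exists v, 0; rewrite linear0 addr0. Qed.

Lemma frame_rP j j' v : frame j j' -> j' v \in P.
Proof. by move=> fr; apply/(frame_P fr); exists 0, v; rewrite linear0 add0r. Qed.

Lemma frame_eq j j' v w v1 w1 : frame j j' ->
  j v + j' w = j v1 + j' w1 -> v = v1 /\ w = w1.
Proof.
move=> fr /eqP; rewrite -subr_eq0 opprD addrACA -!linearB /= => /eqP.
by case/(frame_inj fr) => /subr0_eq-> /subr0_eq->.
Qed.

Lemma gk_act_linear x : x \in s -> linear (act x).
Proof. by have [lin _ _] := gk_module gV; apply: lin. Qed.

Lemma exists_frame : exists j j', frame j j'.
Proof.
have [_ [f [f_inj fP f_s]]] := gk_P gV.
have lin1 : linear (fun v : V => f (v, 0)).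
  by move=> a u v; rewrite -linearP; congr (f (_, _)); rewrite /= scaler0 addr0.
have lin2 : linear (fun v : V => f (0, v)).
  by move=> a u v; rewrite -linearP; congr (f (_, _)); rewrite /= scaler0 addr0.
exists (linfun (fun v => f (v, 0))), (linfun (fun v => f (0, v))).
have act0 x : x \in s -> act x 0 = 0.
  move=> xs; have := gk_act_linear xs (-1) 0 0.
  by rewrite scaler0 add0r scaleN1r addNr.
have fE v w : f (v, w) = f (v, 0) + f (0, w).
  by rewrite -linearD; congr (f (_, _)); rewrite /= ?addr0 ?add0r.
split.
- by move=> x xs v; rewrite !linfun_eq // -f_s // /dsum_act /= act0.
- by move=> x xs v; rewrite !linfun_eq // -f_s // /dsum_act /= act0.
- move=> p; rewrite -fP; split=> [/memv_imgP[[v w] _ ->]|[v [w ->]]].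
    by exists v, w; rewrite !linfun_eq.
  by apply/memv_imgP; exists (v, w); rewrite ?memvf // !linfun_eq // -fE.
- move=> v w; rewrite !linfun_eq // -fE -[RHS](linear0 f) => /f_inj.
  by case=> -> ->.
Qed.

Lemma frame_swap j j' : frame j j' -> frame j' j.
Proof.
case=> js j's jP j_inj; split=> // [p|v w].
  by split=> [/jP|] [v [w ->]]; last apply/jP; exists w, v; rewrite addrC.
by rewrite addrC => /j_inj[].
Qed.

Lemma frame_shear j j' : frame j j' -> frame (j + j') j'.
Proof.
case=> js j's jP j_inj; split=> // [x xs v|p|v w].
- by rewrite !add_lfunE linearDr /= js // j's.
- split=> [/jP|] [v [w ->]]; last apply/jP.
    by exists v, (w - v); rewrite add_lfunE linearB /= -addrA [j' v + _]addrC subrK.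
  by exists v, (v + w); rewrite add_lfunE linearD addrA.
rewrite add_lfunE -addrA -linearD => /j_inj[-> ] /eqP.
by rewrite add0r => /eqP.
Qed.

(* By Schur's lemma, applied to the two components of [f \o j]. *)
Lemma frame_coeffs j j' (f : 'Hom(V, g)) : frame j j' ->
  intertwines f (lbr g) -> (forall v, f v \in P) ->
  exists a b, forall v, f v = a *: j v + b *: j' v.
Proof.
move=> fr f_s fP.
pose h (u : (V * V)%type) := j u.1 + j' u.2.
have h_lin : linear h.
  by move=> a u v; rewrite /h /= !linearP scalerDr addrACA.
have hE := linfun_eq h_lin.
have h_inj : lker (linfun h) == 0%VS.
  apply/lker0P => -[u1 u2] [v1 v2]; rewrite !hE /h /=.
  by case/(frame_eq fr) => -> ->.
(* [h] is injective with image [P], and [f] takes its values there, so this inverse is a true one on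
   them. *)
pose F v := ((linfun h)^-1)%VF (f v).
have FE v : f v = j (F v).1 + j' (F v).2.
  have /(frame_P fr)[w1 [w2 fv]] := fP v.
  by rewrite /F fv -[j w1 + _]/(h (w1, w2)) -hE lker0_lfunK.
have F1_lin : linear (fun v => (F v).1) by move=> a u v; rewrite /F !linearP.
have F2_lin : linear (fun v => (F v).2) by move=> a u v; rewrite /F !linearP.
have F_s x v : x \in s -> F (act x v) = (act x (F v).1, act x (F v).2).
  move=> xs; have := f_s x xs v; rewrite FE linearDr /= (frame_l fr) // (frame_r fr) //.
  by rewrite [in RHS]FE; case: (F (act x v)) => u1 u2 /= /(frame_eq fr)[-> ->].
have [|a aE] := @schur (linfun (fun v => (F v).1)).
  by move=> x xs v; rewrite !linfun_eq // F_s.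
have [|b bE] := @schur (linfun (fun v => (F v).2)).
  by move=> x xs v; rewrite !linfun_eq // F_s.
exists a, b => v; rewrite FE.
by have:= aE v; have := bE v; rewrite !linfun_eq // => -> ->; rewrite !linearZ.
Qed.

(** * Comparison of Omega with the invariant scalar product *)

Section InvariantForm.
Variable B : {symmetric V}.
Hypothesis B_nondeg : nondegenerate B.
Hypothesis B_inv :
  {in s, forall x v w, B (act x v) w + B v (act x w) = 0}.

Lemma gk_form_actl x v w : x \in s -> B (act x v) w = - B v (act x w).
Proof. by move=> xs; apply/eqP; rewrite -addr_eq0 B_inv. Qed.

(* Writing the form as [B (f v) w] makes [f] an endomorphism of the module. *)
Lemma omega_scalar (j j' : 'Hom(V, g)) :
  intertwines j (lbr g) -> intertwines j' (lbr g) ->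
  (forall v, j v \in P) -> (forall v, j' v \in P) ->
  exists c, forall v w, Omega (j v) (j' w) = c * B v w.
Proof.
move=> js j's jP j'P; have [e [f [ef fe]]] := dual_bases B_nondeg.
pose F v := \sum_i Omega (j v) (j' (e i)) *: f i.
have F_lin : linear F.
  move=> a u v; rewrite /F scaler_sumr -big_split /=; apply: eq_bigr => i _.
  by rewrite linearP linearPl scalerDl scalerA.
have FB v w : B (F v) w = Omega (j v) (j' w).
  rewrite linear_sumlz [w in RHS]ef [j' _]linear_sum linear_sumr /=.
  apply: eq_bigr => i _; rewrite [j' (_ *: _)]linearZ linearZr_LR linearZl_LR /= mulrC.
  by rewrite [B (f i) w]symmetric_formC.
have [|c cE] := @schur (linfun F).
  move=> x xs v; rewrite !linfun_eq //; apply/subr0_eq.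
  (* Commutation with [x] is tested against [w]: both [B] and Omega are invariant under [s]. *)
  apply: (nondegenerate_eq0 B_nondeg) => w; rewrite linearBl /= gk_form_actl // !FB.
  rewrite -js // -j's // -opprD addrC.
  rewrite sila_inv ?oppr0 ?gk_PE // gk_hE.
  exact: (subvP (addvSr _ _)).
by exists c => v w; rewrite -FB -[F v]linfun_eq // cE linearZl_LR.
Qed.

(** Pulled back by [j], Omega is a multiple of the symmetric [B] and is also skew. *)
Lemma omega_isotropic (j : 'Hom(V, g)) :
  intertwines j (lbr g) -> (forall v, j v \in P) ->
  forall v w, Omega (j v) (j w) = 0.
Proof.
move=> js jP v w; have [c jc] := omega_scalar js js jP jP.
have: Omega (j v) (j w) = - Omega (j v) (j w).
  rewrite [LHS]sila_skew ?gk_PE //.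
  by rewrite !jc (symmetric_formC B w).
by move/eqP; rewrite -addr_eq0 -mulr2n mulrn_eq0 => /eqP.
Qed.

(** * The action of [z] and the Jacobi identity on [P] *)

Section Bracket.
Variable z : g.
Hypothesis Zz : Z = <[z]>%VS.
Hypothesis PP_s : {in P &, forall p q, [p, q] - Omega p q *: z \in s}.

Lemma gk_z_h : z \in ila_h g.
Proof. by rewrite gk_hE Zz (subvP (addvSl _ _)) ?memv_line. Qed.

Lemma gk_z_s x : x \in s -> [z, x] = 0.
Proof. by apply: (gk_central gV); rewrite Zz memv_line. Qed.

Lemma gk_z_P p : p \in P -> [z, p] \in P.
Proof. by move=> pP; rewrite -gk_PE ila_hPP ?gk_PE ?gk_z_h. Qed.

(** The adjoint action of [z] commutes with [s], so [frame_coeffs] applies to its composite with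
    [j]. The pair [a], [b] is a column of A. *)
Lemma frame_z j j' : frame j j' ->
  exists a b, forall v, [z, j v] = a *: j v + b *: j' v.
Proof.
move=> fr; have zE v : (linfun (lbr g z) \o j)%VF v = [z, j v].
  by rewrite comp_lfunE lfunE.
have [x xs v|v|a [b ab]] := @frame_coeffs _ _ (linfun (lbr g z) \o j)%VF fr.
- rewrite !zE -(frame_l fr) // lbr_leibniz.
  by rewrite [ [x, z] ]lbrC gk_z_s // oppr0 linear0l add0r.
- by rewrite zE gk_z_P // (frame_lP _ fr).
- by exists a, b => v; rewrite -ab zE.
Qed.

(** The [Z]-component of a bracket in [P] is given by Omega, which vanishes on the image of [j]. *)
Lemma frame_l_in_s j j' v w : frame j j' -> [j v, j w] \in s.
Proof.
move=> fr; have jP u := frame_lP u fr.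
by have := PP_s (jP v) (jP w); rewrite (omega_isotropic (frame_l fr)) // scale0r subr0.
Qed.

(* The components along [j'] and along [j] of the Jacobi identity on
   [j v], [j w], [j' u]. *)
Lemma frame_jacobi j j' a b c (fr : frame j j') :
  (forall v, [z, j v] = a *: j v + b *: j' v) ->
  (forall v w, Omega (j v) (j' w) = c * B v w) ->
  let T v w := [j v, j' w] - Omega (j v) (j' w) *: z in
  forall v w u,
    act [j v, j w] u = - (c * b) *: (B w u *: v - B v u *: w) /\
    act (T v u) w - act (T w u) v = (c * a) *: (B w u *: v - B v u *: w).
Proof.
move=> zj jc T v w u; set D := B w u *: v - B v u *: w.
have jP x := frame_lP x fr; have j'P x := frame_rP x fr.
have Ts x y : T x y \in s by apply: PP_s.
have jT x y : [j x, j' y] = T x y + (c * B x y) *: z.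
  by rewrite /T jc subrK.
have jjT x y t : [j t, [j x, j' y] ] =
    - j (act (T x y) t + (c * a) *: (B x y *: t))
    - j' ((c * b) *: (B x y *: t)).
  rewrite lbrC jT linearDl linearZl_LR /= zj (frame_l fr) // !linearD !linearZ /=.
  by rewrite addrA !scalerA mulrAC [c * B x y * b]mulrAC.
have := lbr_jacobi (j v) (j w) (j' u).
rewrite [ [j' u, j v] ]lbrC linearNr /= !jjT [ [j' u, _] ]lbrC.
rewrite (frame_r fr) ?(frame_l_in_s _ _ fr) // => jac.
(* Up to sign, [M] and [N] are the [j]- and [j']-components of the triple bracket in [jjT];
   [frame_inj] makes each vanish separately in the Jacobi sum. *)
pose M x y t := act (T x y) t + (c * a) *: (B x y *: t).
pose N x y (t : V) := (c * b) *: (B x y *: t).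
have [] := frame_inj fr (v := M v u w - M w u v)
  (w := N v u w - N w u v - act [j v, j w] u).
  rewrite -[RHS]jac !linearB /= !opprK addrA [- _ + _ + _]addrACA.
  by rewrite [- _ + j (M v u w)]addrC [- _ + j' (N v u w)]addrC.
move=> /eqP + /eqP; rewrite !subr_eq0 /M /N => /eqP Mvw /eqP <-.
rewrite scalerBr -scalerBr scaleNr -scalerN opprB -scalerBr; split=> //.
apply/eqP; rewrite subr_eq addrC scalerBr addrA eq_sym subr_eq.
by rewrite Mvw eqxx.
Qed.

Lemma gk_module_neq0 : exists v : V, v != 0.
Proof.
have [[V0 _] _] := gk_abs_simple gV.
by exists (vpick {:V}); rewrite vpick0.
Qed.

(** If [c] were 0, the image of [j], already isotropic, would be Omega-orthogonal to all of [P]. *)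
Lemma frame_omega_neq0 j j' c : frame j j' ->
  (forall v w, Omega (j v) (j' w) = c * B v w) -> c != 0.
Proof.
move=> fr jc; have [v] := gk_module_neq0; apply: contra_neq => c0.
suff jv0 : j v = 0 by have [] := frame_inj fr (v := v) (w := 0); rewrite ?linear0 ?addr0.
apply: sila_nondeg.
  by rewrite gk_PE (frame_lP _ fr).
move=> q; rewrite gk_PE => /(frame_P fr)[w [u ->]].
rewrite linearDr /= (omega_isotropic (frame_l fr)) ?jc ?c0 ?mul0r ?addr0 // => x.
exact: (frame_lP _ fr).
Qed.

(** Either A is zero, or some frame has a first vector that is not an eigenvector of A, which is
    what [b != 0] expresses. *)
Lemma gk_z_action :
  {in P, forall p, [z, p] = 0} \/
  exists (j j' : 'Hom(V, g)) (a b : K), [/\ frame j j', b != 0 &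
    forall v, [z, j v] = a *: j v + b *: j' v].
Proof.
have [j [j' fr]] := exists_frame.
have [a [b zj]] := frame_z fr; have [a' [b' zj']] := frame_z (frame_swap fr).
have [b0|] := eqVneq b 0; last by right; exists j, j', a, b.
have [b'0|] := eqVneq b' 0.
  2: by right; exists j', j, a', b'; split=> //; exact: frame_swap.
rewrite {}b0 {}b'0 in zj zj'.
have {}zj v : [z, j v] = a *: j v by rewrite zj scale0r addr0.
have {}zj' v : [z, j' v] = a' *: j' v by rewrite zj' scale0r addr0.
have [a'a|aa'] := eqVneq a' a; last first.
  (* Here A is diagonal with distinct eigenvalues, and the sum of the two eigenvectors is not an
     eigenvector. *)
  right; exists (j + j'), j', a, (a' - a); split; rewrite ?subr_eq0 //.
    exact: frame_shear.
  move=> v; rewrite add_lfunE linearDr /= zj zj' scalerDr scalerBl.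
  by rewrite -addrA [a *: j' v + _]addrC subrK.
rewrite {}a'a in zj'; left.
have jP v := frame_lP v fr; have j'P v := frame_rP v fr.
have [c jc] := omega_scalar (frame_l fr) (frame_r fr) jP j'P.
have c0 := frame_omega_neq0 fr jc.
suff a0 : a = 0.
  move=> p /(frame_P fr)[v [w ->]].
  by rewrite linearDr /= zj zj' a0 !scale0r addr0.
(* A is the scalar [a], so invariance of Omega under [z] reads 2 a c B(v, w) = 0. *)
have [v] := gk_module_neq0; apply: contra_neq_eq => a0.
apply: (nondegenerate_eq0 B_nondeg) => w.
have := sila_inv gk_z_h.
rewrite gk_PE => /(_ _ _ (jP v) (j'P w))/eqP.
rewrite zj zj' linearZl_LR linearZr_LR /= jc -mulr2n mulrn_eq0 /= !mulf_eq0.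
by rewrite (negPf a0) (negPf c0) => /eqP.
Qed.

Lemma frame_faithful j j' x : frame j j' -> x \in s ->
  (forall v, [x, j v] = 0) -> x = 0.
Proof.
move=> fr xs x0; apply: (gk_faithful gV xs) => v.
have [] // := frame_inj fr (v := act x v) (w := 0).
by rewrite linear0 addr0 -(frame_l fr) // x0.
Qed.

(** With [a = b = 0], [frame_jacobi] kills the brackets inside each copy of [V] and makes
    [act (T v u) w] symmetric in [v] and [w]. This symmetry forces [T = 0], so [[P, P]] lies in the
    line of [z]. *)
Lemma gk_flat : {in P, forall p, [z, p] = 0} -> lie_flat P.
Proof.
move=> zP; have [j [j' fr]] := exists_frame.
have no_bracket (k k' : 'Hom(V, g)) : frame k k' -> forall v w, [k v, k w] = 0.
  move=> fk v w; apply: (gk_faithful gV (frame_l_in_s _ _ fk)) => u.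
  have [c kc] := omega_scalar (frame_l fk) (frame_r fk)
    (fun v => frame_lP v fk) (fun v => frame_rP v fk).
  have zk x : [z, k x] = 0 *: k x + 0 *: k' x.
    by rewrite zP ?(frame_lP _ fk) // !scale0r addr0.
  by have [-> _] := frame_jacobi fk zk kc v w u; rewrite mulr0 oppr0 scale0r.
have [c jc] := omega_scalar (frame_l fr) (frame_r fr)
    (fun v => frame_lP v fr) (fun v => frame_rP v fr).
have zj x : [z, j x] = 0 *: j x + 0 *: j' x.
  by rewrite zP ?(frame_lP _ fr) // !scale0r addr0.
pose T v w := [j v, j' w] - Omega (j v) (j' w) *: z.
have Ts v w : T v w \in s by apply: PP_s; rewrite ?(frame_lP _ fr) ?(frame_rP _ fr).
have Tsym v w u : act (T v u) w = act (T w u) v.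
  by have [_ /eqP] := frame_jacobi fr zj jc v w u;
    rewrite mulr0 scale0r subr_eq0 => /eqP.
pose F v u w x := B (act (T v u) w) x.
have F13 v u w x : F v u w x = F w u v x by rewrite /F Tsym.
have F34 v u w x : F v u w x = - F v u x w.
  by rewrite /F gk_form_actl // symmetric_formC.
(* [F] is symmetric in slots 1, 3 and skew in slots 3, 4. The two sides of the braid relation
   between these transpositions then give opposite signs. *)
have F0 v u w x : F v u w x = 0.
  have: F v u w x = - F v u w x.
    by rewrite [LHS]F13 [LHS]F34 (F13 w) (F34 x) opprK (F13 x) [LHS]F34.
  by move/eqP; rewrite -addr_eq0 -mulr2n mulrn_eq0 => /eqP.
have T0 v u : T v u = 0.
  apply: (gk_faithful gV (Ts v u)) => w.
  by apply: (nondegenerate_eq0 B_nondeg) => x; exact: F0.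
have PPz : (lbrv P P <= <[z]>)%VS.
  have jj'z v w : [j v, j' w] \in <[z]>%VS.
    by rewrite (subr0_eq (T0 v w)) memvZ ?memv_line.
  apply/lbrv_subP => _ _ /(frame_P fr)[v [w ->]] /(frame_P fr)[v1 [w1 ->]].
  rewrite linearDl !linearDr /= (no_bracket _ _ fr) (no_bracket _ _ (frame_swap fr)).
  by rewrite add0r addr0 memvD // lbrC memvN.
by move=> x p /(subvP PPz)/vlineP[k ->] pP; rewrite linearZl_LR /= zP ?scaler0.
Qed.

(* For [x] skew and dual bases [e], [f] of [B], the sum over [i] of
   [B (f i) u *: x (e i) - B (x (e i)) u *: f i] is [2 x u]; by
   [frame_jacobi] the brackets [j (x (e i)), j (f i)] act by its terms. *)
Lemma frame_s_sub_PP j j' a b : frame j j' ->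
  (forall v, [z, j v] = a *: j v + b *: j' v) -> b != 0 -> (s <= lbrv P P)%VS.
Proof.
move=> fr zj b0; have [c jc] := omega_scalar (frame_l fr) (frame_r fr)
    (fun v => frame_lP v fr) (fun v => frame_rP v fr).
have c0 := frame_omega_neq0 fr jc.
have [e [f [ef fe]]] := dual_bases B_nondeg.
apply/subvP => x xs; pose k := - (c * b) * 2%:R.
have k0 : k != 0 by rewrite mulf_eq0 oppr_eq0 mulf_eq0 (negPf c0) (negPf b0) pnatr_eq0.
pose y := k^-1 *: \sum_i [j (act x (e i)), j (f i)].
have yPP : y \in lbrv P P.
  by rewrite memvZ // memv_suml // => i _; rewrite memv_lbr ?(frame_lP _ fr).
have ys : y \in s.
  by rewrite memvZ // memv_suml // => i _; exact: (frame_l_in_s _ _ fr).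
suff -> : x = y by [].
apply/subr0_eq/(frame_faithful fr) => [|u]; first exact: memvB.
rewrite linearBl /= linearZl_LR linear_sumlz /= (frame_l fr) //.
have brE i : [ [j (act x (e i)), j (f i)], j u] =
    - (c * b) *: j (B u (f i) *: act x (e i) + B (act x u) (e i) *: f i).
  rewrite (frame_l fr) ?(frame_l_in_s _ _ fr) //.
  have [-> _] := frame_jacobi fr zj jc (act x (e i)) (f i) u; rewrite linearZ /=.
  rewrite (symmetric_formC B (f i)) [B (act x (e i)) u]gk_form_actl //.
  by rewrite [(- B _ _) *: _]scaleNr opprK (symmetric_formC B (e i)).
under eq_bigr => i _ do rewrite brE.
(* By [fe] the second family sums to [act x u]; applying [x] to the expansion [ef] of [u] gives the
   same for the first, whence the 2 in [k]. *)
rewrite -scaler_sumr -linear_sum big_split /= -fe.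
have -> : \sum_i B u (f i) *: act x (e i) = act x u.
  have lx := linfun_eq (gk_act_linear xs).
  rewrite [in RHS](ef u) -lx linear_sum; apply: eq_bigr => i _.
  by rewrite linearZ /= lx.
rewrite linearD -mulr2n -scaler_nat !scalerA -/k -mulrA -/k mulVf // scale1r subrr //.
Qed.

Lemma transv_full : ~ lie_flat P ->
  lbrv P P = (Z + s)%VS /\ transv_n g = 0%VS.
Proof.
move=> nonflat; case: gk_z_action => [/gk_flat//|[j [j' [a [b [fr b0 zj]]]]]].
have sPP := frame_s_sub_PP fr zj b0.
have PPh : lbrv P P = (Z + s)%VS.
  apply/eqP; rewrite eqEsubv -[X in (_ <= X)%VS]gk_hE -{1 2}gk_PE ila_PPh /=.
  rewrite subv_add sPP andbT Zz -memvE.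
  have [c jc] := omega_scalar (frame_l fr) (frame_r fr)
    (fun v => frame_lP v fr) (fun v => frame_rP v fr).
  have c0 := frame_omega_neq0 fr jc.
  (* For [B v w != 0], removing from [[j v, j' w]] its component in [s] leaves a nonzero multiple of
     [z], still in [[P, P]]. *)
  have [v v0] := gk_module_neq0.
  have : v \notin orthov B fullv by rewrite (eqP B_nondeg) memv0.
  case/mem_orthovPn => w _ vw0.
  have [jvP j'wP] := (frame_lP v fr, frame_rP w fr).
  have := memvB (memv_lbr jvP j'wP) (subvP sPP _ (PP_s jvP j'wP)).
  by rewrite subKr jc rpredZeq mulf_eq0 (negPf c0) (negPf vw0).
split=> //; apply/eqP; rewrite -subv0; apply/subvP => x.
rewrite memv_cap gk_PE PPh Zz => /andP[/memv_addP[_ /vlineP[k ->] [y ys ->]] /lcentP xP].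
(* This is the [j']-component of the bracket of [k *: z + y] with [j v], as [y] preserves the image
   of [j]. With [b != 0] it gives [k = 0], and faithfulness then gives [y = 0]. *)
have k0 (v : V) : (k * b) *: v = 0.
  have := xP (j v) (frame_lP v fr).
  rewrite linearDl linearZl_LR /= zj (frame_l fr) // scalerDr !scalerA.
  rewrite addrAC -[_ *: j v]linearZ -[_ *: j' v]linearZ -linearD /=.
  by case/(frame_inj fr).
have [v v0] := gk_module_neq0.
have /eqP := k0 v; rewrite scaler_eq0 mulf_eq0 (negPf v0) (negPf b0) !orbF => /eqP k00.
rewrite k00 scale0r add0r memv0; apply/eqP/(frame_faithful fr ys) => u.
by have := xP (j u) (frame_lP u fr); rewrite k00 scale0r add0r.
Qed.

End Bracket.
End InvariantForm.
End Kinematical.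

(** * Transport of a kinematical structure along a Lie algebra isomorphism *)

Section Transport.
Variables (K : numFieldType) (g g' : lieAlgebra K).
Variables (phi : 'Hom(g, g')) (psi : 'Hom(g', g)).
Hypothesis phi_br : lie_morphism phi.
Hypotheses (phiK : cancel phi psi) (psiK : cancel psi phi).

Lemma lker_iso : lker phi = 0%VS.
Proof. by apply/eqP/lker0P; exact: can_inj phiK. Qed.

Lemma dim_limg_iso (U : {vspace g}) : \dim (phi @: U) = \dim U.
Proof. by rewrite limg_dim_eq // lker_iso capv0. Qed.

Lemma mem_limg_iso (U : {vspace g}) x : (phi x \in phi @: U)%VS = (x \in U).
Proof. by rewrite memvE -limg_line limg_ker0 ?lker_iso // -memvE. Qed.

Lemma forall_limg_iso (U : {vspace g}) (Q : g' -> Prop) :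
  {in U, forall x, Q (phi x)} -> {in (phi @: U)%VS, forall x, Q x}.
Proof. by move=> UQ _ /memv_imgP[x xU ->]; apply: UQ. Qed.

Section Module.
Variables (s : {vspace g}) (M W : vectType K).
Variables (actM : g -> M -> M) (actW : g -> W -> W).

(** Used for the exterior square: no new copy of [V] appears when the actions are precomposed with
    [psi]. *)
Lemma submodule_iso_transport (U : {vspace W}) :
  submodule_iso (phi @: s) (actM \o psi) (actW \o psi) U ->
  submodule_iso s actM actW U.
Proof.
have phi_s x : x \in s -> phi x \in (phi @: s)%VS by move=> xs; rewrite mem_limg_iso.
case=> Us [f [f_inj fU f_s]]; split=> [x u xs uU|].
  by have /= := Us _ u (phi_s x xs) uU; rewrite phiK.
exists f; split=> // x xs v.
by have /= := f_s _ (phi_s x xs) v; rewrite phiK.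
Qed.

End Module.

Lemma generic_kinematical_transport (s Z P : {vspace g}) (V : vectType K)
    (act : g -> V -> V) :
  generic_kinematical s act Z P ->
  generic_kinematical (phi @: s) (act \o psi) (phi @: Z) (phi @: P).
Proof.
move=> gV; split.
- move=> _ _ /memv_imgP[x xs ->] /memv_imgP[y ys ->].
  by rewrite -phi_br mem_limg_iso (gk_subalgebra gV).
- have [lin1 lin2 act_br] := gk_module gV; split.
  + by apply: forall_limg_iso => x xs; rewrite /= phiK; exact: lin1.
  + move=> c v _ _ /memv_imgP[x xs ->] /memv_imgP[y ys ->] /=.
    by rewrite -linearP /= !phiK lin2.
  + move=> _ _ /memv_imgP[x xs ->] /memv_imgP[y ys ->] v /=.
    by rewrite -phi_br !phiK act_br.
- apply: forall_limg_iso => x xs; rewrite /= phiK => /(gk_faithful gV xs) ->.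
  exact: linear0.
- have [[V0 V_simple] V_abs] := gk_abs_simple gV; split.
    split=> // U Us; apply: V_simple => x u xs uU.
    by have /= := Us (phi x) u; rewrite mem_limg_iso phiK; apply.
  move=> f f_s; apply: V_abs => x xs v.
  by have /= := f_s (phi x); rewrite mem_limg_iso phiK; apply.
- move=> w [r rP wr]; apply: (gk_ext2 gV); exists r => // U Ur.
  have [UX Uiso] := rP U Ur; split=> //.
  exact: submodule_iso_transport Uiso.
- have [B [B0 B_inv]] := gk_scalar_product gV; exists B; split=> //.
  by apply: forall_limg_iso => x xs; rewrite /= phiK; exact: B_inv.
- have := gk_directv gV.
  by rewrite !directvE /= -!limgD !dim_limg_iso.
- rewrite -!limgD (gk_sum gV); apply/eqP; rewrite eqEsubv subvf /=.
  by apply/subvP => x _; rewrite -[x]psiK memv_img ?memvf.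
- by rewrite dim_limg_iso (gk_line gV).
- move=> _ _ /memv_imgP[x xZ ->] /memv_imgP[y ys ->].
  by rewrite -phi_br (gk_central gV) ?linear0.
- have [P_s [f [f_inj fP f_s]]] := gk_P gV; split.
    move=> _ _ /memv_imgP[x xs ->] /memv_imgP[p pP ->].
    by rewrite -phi_br mem_limg_iso P_s.
  exists (phi \o f)%VF; split.
  + by move=> u v; rewrite !comp_lfunE => /(can_inj phiK)/f_inj.
  + by rewrite limg_comp fP.
  + apply: forall_limg_iso => x xs v; rewrite !comp_lfunE -phi_br -f_s //.
    by rewrite /dsum_act /= phiK.
Qed.

End Transport.

Theorem proposition4p3 (R : realType) (K : numFieldType)
    (K_real_or_complex : K = R :> numFieldType \/ K = R[i] :> numFieldType)
    (g : siLa K) (s Z P : {vspace g}) (V : vectType K) (act : g -> V -> V)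
    (gV : @generic_kinematical K g s V act Z P)
    (g_associated : @associated_sila K g s Z P)
    (g_indecomposable : ~ sila_decomposable g)
    (g_nonflat : ~ ila_flat g) :
  let s0 := @kinematical_s K g s Z P in
  exists (Zt : {vspace transvection g}) (act_t : transvection g -> V -> V),
    [/\ (Zt <= ila_h (transvection g))%VS,
        {in s0, forall x v, act_t (transv_proj g x) v = act x v}
      & @generic_kinematical K (transvection g) (transv_proj g @: s0)%VS V act_t
          Zt (ila_P (transvection g))].
Proof.
move=> s0; have gP := gk_PE gV g_associated; have gh := gk_hE gV g_associated.
have [B [B_nondeg B_inv]] := gk_scalar_product gV.
have [_ _ [z Zz PP_s]] := g_associated.
rewrite /ila_flat gP in g_nonflat.
have [PPh n0] := transv_full gV g_associated B_nondeg B_inv Zz PP_s g_nonflat.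
have Efull x : x \in transv_E g.
  by rewrite /transv_E gP PPh (gk_sum gV) memvf.
(* The projection is defined modulo [transv_n g], which is 0, on [transv_E g], which is everything;
   it is thus an isomorphism. *)
have projK : cancel (transv_proj g) (transv_repr g).
  move=> x; apply/esym/subr0_eq/eqP; rewrite -memv0 -n0.
  exact: transv_projK.
have proj_br : lie_morphism (transv_proj g).
  by move=> x y; apply: transv_proj_br.
(* As [[P, P]] is all of [Z + s], the kernel in it of the projection to [Z] is [s] itself. *)
have s0E : s0 = s.
  have ZsP0 : (Z :&: s = 0)%VS.
    by apply/directv_addP; have := gk_directv gV; rewrite directv_addE => /and3P[].
  apply/vspaceP => x; rewrite memv_cap PPh memv_ker; apply/andP/idP => [[xh /eqP x0]|xs].
    by rewrite -(daddv_pi_add ZsP0 xh) x0 add0r memv_pi.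
  have xh : x \in (Z + s)%VS by rewrite (subvP (addvSr _ _)).
  split=> //; apply/eqP.
  have := daddv_pi_add ZsP0 xh.
  rewrite [daddv_pi s Z x]daddv_pi_id 1?capvC // => /eqP.
  by rewrite -subr_eq0 addrK => /eqP.
exists (transv_proj g @: Z)%VS, (act \o transv_repr g); split.
- apply/subvP => _ /memv_imgP[x xZ ->]; apply/transv_hP; exists x => //.
  by rewrite gP PPh (subvP (addvSl _ _)).
- by move=> x _ v; rewrite /= projK.
have -> : ila_P (transvection g) = (transv_proj g @: P)%VS.
  apply/vspaceP => a; apply/transv_PP/memv_imgP; rewrite gP.
    by case=> p pP ->; exists p.
  by case=> p pP ->; exists p.
rewrite s0E; exact: (generic_kinematical_transport proj_br projK (@transv_reprK _ g)).
Qed.
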